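(* Let $K$ be a field, let $n\ge 1$, and let $\Gamma$ be a finite subgroup of $\mathrm{PGL}_{n+1}(K)$, acting on $K[x_0,\dots,x_n]$ and on polynomial differential forms through its preimage in $\mathrm{SL}_{n+1}$. For an ordered index set $I=\{i_1,\dots,i_n\}\subset\{0,1,\dots,n\}$ with $i_1<\dots<i_n$, let $\hat{i}$ be the unique index of $\{0,\dots,n\}$ not in $I$, let $\sigma_I$ be the permutation $\begin{pmatrix}0&1&\cdots&n\\ \hat{i}&i_1&\cdots&i_n\end{pmatrix}$, and set $$dX^I=(-1)^{\sigma_I}\,dx_{i_1}\wedge\cdots\wedge dx_{i_n},$$ where $(-1)^{\sigma_I}$ is the sign of $\sigma_I$. Then the $\Gamma$-invariant $n$-forms $$\phi=\sum_{\hat{i}=0}^{n} f_{\hat{i}}\,dX^I$$ (with $f_0,\dots,f_n$ homogeneous polynomials of a common degree) are in one-to-one correspondence with the maps $f=(f_0,\dots,f_n)$ of $\mathbb{P}^n$ satisfying $\Gamma\subseteq\mathrm{Aut}(f)$, the correspondence sending $\phi$ to $f=(f_0,\dots,f_n)$.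
   Context: The group $\Gamma$ acts on polynomials by $(\gamma F)(v)=F(\gamma^{-1}v)$, and on polynomial differential forms (elements of $K[x_0,\dots,x_n]\otimes\Lambda(dx_0,\dots,dx_n)$) by $\gamma\phi(\bar x)=\phi(\gamma^{-1}\bar x)$ extended to the exterior algebra. A form (or polynomial) $\phi$ is called $\Gamma$-invariant (a relative invariant) if there is a linear character $\chi$ of $\Gamma$ with $\gamma\phi=\chi(\gamma)\phi$ for all $\gamma\in\Gamma$. For a map $f:\mathbb{P}^n\to\mathbb{P}^n$ given by homogeneous polynomials, $\mathrm{Aut}(f)=\{\alpha\in\mathrm{PGL}_{n+1}: \alpha\circ f\circ\alpha^{-1}=f\}$, where equality is as maps of projective space (so polynomial tuples are taken up to scalar multiple). *)

(* Defs.v *)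
From HB Require Import structures.
From mathcomp Require Import all_boot all_order all_algebra perm.
From mathcomp Require Import finmap.
From mathcomp.multinomials Require Import mpoly.

Set Implicit Arguments.
Unset Strict Implicit.
Unset Printing Implicit Defensive.

Import GRing.Theory.
Local Open Scope ring_scope.
Local Open Scope quotient_scope.

Section ProjectiveLinearGroup.
Variables (K : fieldType) (n : nat).

Definition GL := {A : 'M[K]_n | A \in unitmx}.
HB.instance Definition _ := SubType.on GL.
HB.instance Definition _ := Choice.on GL.

Implicit Types A B C : GL.

Fact GL_one_unit : (1%:M : 'M[K]_n) \in unitmx.
Proof. exact: unitmx1. Qed.
Fact GL_mul_unit A B : val A *m val B \in unitmx.
Proof. by rewrite unitmx_mul (valP A) (valP B). Qed.
Fact GL_inv_unit A : invmx (val A) \in unitmx.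
Proof. by rewrite unitmx_inv (valP A). Qed.

Definition GL_one : GL := Sub 1%:M GL_one_unit.
Definition GL_mul A B : GL := Sub (val A *m val B) (GL_mul_unit A B).
Definition GL_inv A : GL := Sub (invmx (val A)) (GL_inv_unit A).

Fact GL_mulA : associative GL_mul.
Proof. by move=> A B C; apply: val_inj; rewrite /= mulmxA. Qed.
Fact GL_mul1 : left_id GL_one GL_mul.
Proof. by move=> A; apply: val_inj; rewrite /= mul1mx. Qed.
Fact GL_1mul : right_id GL_one GL_mul.
Proof. by move=> A; apply: val_inj; rewrite /= mulmx1. Qed.
Fact GL_mulV : left_inverse GL_one GL_inv GL_mul.
Proof. by move=> A; apply: val_inj; rewrite /= mulVmx ?(valP A). Qed.
Fact GL_Vmul : right_inverse GL_one GL_inv GL_mul.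
Proof. by move=> A; apply: val_inj; rewrite /= mulmxV ?(valP A). Qed.

HB.instance Definition _ :=
  isGroup.Build GL GL_mulA GL_mul1 GL_1mul GL_mulV GL_Vmul.

(* A and B have the same class in PGL when A B^-1 is a scalar matrix. *)
Definition GL_equiv A B := is_scalar_mx (val A *m invmx (val B)).

Lemma GL_equivP A B :
  reflect (exists2 c : K, c != 0 & val A = c *: val B) (GL_equiv A B).
Proof.
apply: (iffP is_scalar_mxP) => [[c Ec] | [c _ ->]]; last first.
  by exists c; rewrite -scalemxAl mulmxV ?(valP B) // scalemx1.
have EA : val A = c *: val B.
  by rewrite -[LHS](mulmxKV (valP B)) Ec mul_scalar_mx.
have [c0 | c_neq0] := eqVneq c 0; last by exists c.
exists 1; first exact: oner_neq0.
have uA := valP A; rewrite EA c0 scale0r in uA.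
have A0 X : X = 0 :> 'M[K]_n by rewrite -[X](mulmxK uA) mulmx0 mul0mx.
by rewrite (A0 (val A)) (A0 (1 *: _)).
Qed.

Fact GL_equiv_refl : reflexive GL_equiv.
Proof. by move=> A; apply/GL_equivP; exists 1; rewrite ?oner_neq0 ?scale1r. Qed.
Fact GL_equiv_sym : ssrbool.symmetric GL_equiv.
Proof.
suff S A B : GL_equiv A B -> GL_equiv B A.
  by move=> A B; apply/idP/idP; apply: S.
move=> /GL_equivP[c c0 E]; apply/GL_equivP; exists c^-1; first by rewrite invr_eq0.
by rewrite E scalerA mulVf // scale1r.
Qed.
Fact GL_equiv_trans : transitive GL_equiv.
Proof.
move=> B A C /GL_equivP[c c0 E] /GL_equivP[d d0 F]; apply/GL_equivP.
by exists (c * d); rewrite ?mulf_neq0 // E F scalerA.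
Qed.

Canonical GL_equiv_rel :=
  EquivRel GL_equiv GL_equiv_refl GL_equiv_sym GL_equiv_trans.

Definition PGL := {eq_quot GL_equiv_rel}.
HB.instance Definition _ := Choice.on PGL.
HB.instance Definition _ := EqQuotient.on PGL.

Definition PGL_class A : PGL := \pi_PGL A.

Lemma PGL_classP A B :
  reflect (exists2 c : K, c != 0 & val A = c *: val B)
          (PGL_class A == PGL_class B).
Proof. by rewrite /PGL_class piE; apply: GL_equivP. Qed.

Definition PGL_one : PGL := PGL_class 1%g.
Definition PGL_mul (a b : PGL) : PGL := PGL_class (repr a * repr b)%g.
Definition PGL_inv (a : PGL) : PGL := PGL_class (repr a)^-1%g.

Lemma PGL_reprK a : PGL_class (repr a) = a. Proof. exact: reprK. Qed.

Lemma PGL_class_repr A : exists2 c : K, c != 0 & val (repr (PGL_class A)) = c *: val A.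
Proof. by apply/PGL_classP; rewrite PGL_reprK. Qed.

Lemma PGL_classM A B : PGL_class (A * B)%g = PGL_mul (PGL_class A) (PGL_class B).
Proof.
apply/eqP; rewrite eq_sym; apply/PGL_classP.
have [c c0 E] := PGL_class_repr A; have [d d0 F] := PGL_class_repr B.
by exists (c * d); rewrite ?mulf_neq0 //= E F -scalemxAl -scalemxAr scalerA.
Qed.

Lemma PGL_classV A : PGL_class A^-1%g = PGL_inv (PGL_class A).
Proof.
apply/eqP; rewrite eq_sym; apply/PGL_classP.
have [c c0 E] := PGL_class_repr A; exists c^-1; first by rewrite invr_eq0.
by rewrite [LHS]/= E invmxZ // -E; apply: valP.
Qed.

Fact PGL_mulA : associative PGL_mul.
Proof.
move=> a b c; rewrite -[a]PGL_reprK -[b]PGL_reprK -[c]PGL_reprK.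
by rewrite -!PGL_classM mulgA.
Qed.
Fact PGL_mul1 : left_id PGL_one PGL_mul.
Proof. by move=> a; rewrite -[a]PGL_reprK -PGL_classM mul1g. Qed.
Fact PGL_1mul : right_id PGL_one PGL_mul.
Proof. by move=> a; rewrite -[a]PGL_reprK -PGL_classM mulg1. Qed.
Fact PGL_mulV : left_inverse PGL_one PGL_inv PGL_mul.
Proof. by move=> a; rewrite -[a]PGL_reprK -PGL_classV -PGL_classM mulVg. Qed.
Fact PGL_Vmul : right_inverse PGL_one PGL_inv PGL_mul.
Proof. by move=> a; rewrite -[a]PGL_reprK -PGL_classV -PGL_classM mulgV. Qed.

HB.instance Definition _ :=
  isGroup.Build PGL PGL_mulA PGL_mul1 PGL_1mul PGL_mulV PGL_Vmul.

End ProjectiveLinearGroup.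

Section BaseChange.
Variables (K L : fieldType) (iota : {rmorphism K -> L}) (n : nat).

Fact GL_map_unit (A : GL K n) : map_mx iota (val A) \in unitmx.
Proof. by rewrite map_unitmx (valP A). Qed.
Definition GL_map (A : GL K n) : GL L n := Sub (map_mx iota (val A)) (GL_map_unit A).
Definition PGL_map (a : PGL K n) : PGL L n := PGL_class (GL_map (repr a)).

(* The preimage in SL_n(L) of a set of elements of PGL_n(K). *)
Definition SL_preimage (Gamma : {fset PGL K n}) (A : GL L n) : Prop :=
  \det (val A) = 1 /\ exists2 a, a \in Gamma & PGL_class A = PGL_map a.

End BaseChange.

Definition linear_character (L : fieldType) (n : nat) (H : GL L n -> Prop)
    (chi : GL L n -> L) : Prop :=
  (forall A, H A -> chi A != 0) /\
  (forall A B, H A -> H B -> chi (A * B)%g = chi A * chi B).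

Definition proportional (K : fieldType) (V : lmodType K) (u v : V) : Prop :=
  exists2 c : K, c != 0 & u = c *: v.

Section Forms.
Variables (K : fieldType) (n : nat).

Definition polymap := {ffun 'I_n -> {mpoly K[n]}}.

Definition polymap_comp (f g : polymap) : polymap :=
  [ffun i => f i \mPo [tuple g j | j < n]].

(* The linear map v |-> A v on column vectors. *)
Definition linear_polymap (A : 'M[K]_n) : polymap :=
  [ffun i => \sum_j A i j *: 'X_j].

(* Maps P^(n-1) -> P^(n-1) are such tuples, taken up to proportionality; *)
(* common factors (hence indeterminacy) are allowed.                     *)
Definition is_projective_map (f : polymap) : Prop :=
  f != 0 /\ exists d, forall i, f i \is d.-homog.

(* For homogeneous f this does not depend on the representative of a. *)
Definition in_Aut (f : polymap) (a : PGL K n) : Prop :=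
  proportional
    (polymap_comp (linear_polymap (val (repr a)))
      (polymap_comp f (linear_polymap (invmx (val (repr a)))))) f.

(* K[x_0, ..., x_(n-1)] (x) Lambda(dx_0, ..., dx_(n-1)), in the basis of the *)
(* increasing products dx_S = dx_s1 /\ ... /\ dx_sk, S = {s1 < ... < sk}.    *)
Definition dform := {ffun {set 'I_n} -> {mpoly K[n]}}.

Implicit Types (phi psi : dform) (p : {mpoly K[n]}).

Definition dform_one : dform := [ffun S => (S == set0)%:R].
Definition dx (i : 'I_n) : dform := [ffun S => (S == [set i])%:R].
Definition pscale p phi : dform := [ffun S => p * phi S].

(* dx_A /\ dx_B = (-1)^(inversions A B) dx_(A :|: B) for A, B disjoint. *)
Definition inversions (A B : {set 'I_n}) : nat :=
  #|[set u in setX A B | (u.2 < u.1)%N]|.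
Definition wedge phi psi : dform :=
  [ffun S => \sum_(A in powerset S)
     (-1) ^+ inversions A (S :\: A) * phi A * psi (S :\: A)].

Definition is_kform (k : nat) phi : Prop :=
  forall S : {set 'I_n}, #|S| != k -> phi S = 0.

Definition homog_coefs phi : Prop := exists d, forall S, phi S \is d.-homog.

Definition act_poly (A : GL K n) p : {mpoly K[n]} :=
  p \mPo [tuple linear_polymap (val A^-1%g) i | i < n].

(* d(x_i o A^-1) *)
Definition act_dx (A : GL K n) (i : 'I_n) : dform :=
  \sum_j val A^-1%g i j *: dx j.

(* enum S lists S in increasing order. *)
Definition act_dform (A : GL K n) phi : dform :=
  \sum_(S : {set 'I_n})
     pscale (act_poly A (phi S))
            (\big[wedge/dform_one]_(i <- enum S) act_dx A i).

End Forms.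

Definition map_dform (K L : fieldType) (iota : {rmorphism K -> L}) (n : nat)
    (phi : dform K n) : dform L n :=
  [ffun S => map_mpoly iota (phi S)].

(* Relative invariance under the preimage of Gamma in SL_n(L). *)
Definition invariant_form (K L : fieldType) (iota : {rmorphism K -> L})
    (n : nat) (Gamma : {fset PGL K n}) (phi : dform K n) : Prop :=
  exists2 chi : GL L n -> L, linear_character (SL_preimage iota Gamma) chi &
    forall A, SL_preimage iota Gamma A ->
      act_dform A (map_dform iota phi) = chi A *: map_dform iota phi.

Section FormOfMap.
Variables (K : fieldType) (n : nat).

(* sigma_I maps 0 to i and k+1 to the k-th index different from i *)
(* (counting from 0), namely lift i k.                            *)
Definition sigma (i : 'I_n.+1) : 'S_n.+1 := lift_perm ord0 i 1%g.

(* dX^I for I the complement of i. *)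
Definition dX (i : 'I_n.+1) : dform K n.+1 :=
  (-1) ^+ sigma i *: \big[@wedge K n.+1/@dform_one K n.+1]_(k < n) dx K (lift i k).

Definition form_of_map (f : polymap K n.+1) : dform K n.+1 :=
  \sum_i pscale (f i) (dX i).

End FormOfMap.

(* Main.v *)
(**
  Writing B = A^-1, the coefficient of a wedge of rows of B on dx_T is a minor
  of B, so on n-forms in n+1 variables A acts through the cofactors of B, that
  is, through the adjugate of A^-1. With the signs of dX^I this adjugate is
  det(B) A, whence A . form_of_map f = det(A)^-1 form_of_map (A o f o A^-1): for
  A in SL the correspondence is equivariant, and relative invariance of the form
  is proportionality of f and A o f o A^-1. Every element of PGL(K) lifts to SL
  over an algebraically closed L after extracting a root of the determinant,
  which changes A o f o A^-1 only by a scalar since f is homogeneous; the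
  proportionality factor descends to K because it is a quotient of
  coefficients.
*)
Require Import Defs.
From HB Require Import structures.
From mathcomp Require Import all_boot all_order all_algebra perm.
From mathcomp Require Import finmap.
From mathcomp.multinomials Require Import mpoly.

Set Implicit Arguments.
Unset Strict Implicit.
Unset Printing Implicit Defensive.

Import GRing.Theory.
Local Open Scope ring_scope.

(** * Increasing maps of ordinals and complements of singletons *)

Lemma homo_ltn_inj m n (t : 'I_m -> 'I_n) :
  {homo t : i j / (i < j)%N} -> injective t.
Proof.
move=> tH i j eq_t; apply/val_inj/eqP.
by case: ltngtP => // /tH; rewrite eq_t ltnn.
Qed.

Lemma homo_ltn_lift n (i : 'I_n.+1) : {homo lift i : k l / (k < l)%N}.
Proof.
move=> k l lt_kl; rewrite /= /bump -addnS leq_add //.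
by case: (leqP i k) => //= /leq_trans/(_ (ltnW lt_kl)) ->.
Qed.

Lemma imset_lift n (i : 'I_n.+1) : [set lift i k | k : 'I_n] = ~: [set i].
Proof.
apply/setP=> j; rewrite !inE; apply/imsetP/idP => [[k _ ->]|].
  by rewrite eq_sym neq_lift.
by rewrite eq_sym => /unlift_some[k -> _]; exists k.
Qed.

(** [act_dform] multiplies along [enum S] while [dX] multiplies along [lift i]. The two lists agree
    because both are strictly increasing with the same elements. *)
Lemma enum_setC1 n (i : 'I_n.+1) :
  enum (~: [set i]) = [seq lift i k | k <- enum 'I_n].
Proof.
have ltn_tr m : transitive (fun k l : 'I_m => (k < l)%N).
  by move=> ? ? ?; apply: ltn_trans.
have enum_sorted m : sorted (fun k l : 'I_m => (k < l)%N) (enum 'I_m).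
  by have := iota_ltn_sorted 0 m; rewrite -val_enum_ord sorted_map.
apply: (@irr_sorted_eq _ (fun k l : 'I_n.+1 => (k < l)%N)).
- exact: ltn_tr.
- by move=> k; rewrite /= ltnn.
- apply: sorted_filter; first exact: ltn_tr.
  by rewrite -enumT; apply: enum_sorted.
- by apply: (homo_sorted (@homo_ltn_lift n i)).
move=> j; rewrite mem_enum -imset_lift; apply/imsetP/mapP => -[k _ ->];
  by exists k; rewrite ?mem_enum.
Qed.

Lemma card_ord_lt n (i : 'I_n) : #|[set k : 'I_n | (k < i)%N]| = i.
Proof.
have le_in := ltnW (ltn_ord i).
rewrite -[RHS]card_ord -(card_imset _ (@homo_ltn_inj _ _ (widen_ord le_in) _)) //.
apply/eq_card=> k; rewrite inE.
apply/idP/imsetP => [lt_ki|[l _ ->] /=]; last exact: ltn_ord.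
by exists (Ordinal lt_ki) => //; apply: val_inj.
Qed.

(** Hence an [n]-form in [n.+1] variables has exactly one coefficient for each omitted index. *)
Lemma card_setC1P n (S : {set 'I_n.+1}) :
  reflect (exists i, S = ~: [set i]) (#|S| == n).
Proof.
have := cardsC S; rewrite card_ord => cardS.
apply: (iffP eqP) => [eq_n|[i ->]]; last first.
  by have := cardsC [set i]; rewrite cards1 card_ord add1n => -[].
have /cards1P[i Ei] : #|~: S| == 1%N by rewrite -(eqn_add2l #|S|) cardS eq_n addn1.
by exists i; rewrite -Ei setCK.
Qed.

(** * Wedge products of constant 1-forms as minors *)

Section Wedge.
Variables (K : fieldType) (n : nat).
Implicit Types (psi : dform K n) (T : {set 'I_n}).

(** With [w] the row [i] of the inverse of [A], this is [act_dx A i]. *)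
Definition one_form (w : 'I_n -> K) : dform K n := \sum_j w j *: dx K j.

(** A 1-form is supported on singletons, so among the splittings of [T] only those with first block
    [[set j]] survive. *)
Lemma wedge_one_form w psi T :
  wedge (one_form w) psi T =
  \sum_(j in T) (-1) ^+ inversions [set j] (T :\ j) * (w j *: psi (T :\ j)).
Proof.
rewrite ffunE.
under eq_bigr => A _.
  rewrite /one_form sum_ffunE mulr_sumr mulr_suml.
  under eq_bigr => j _ do rewrite ffunE /= ffunE.
  over.
rewrite exchange_big [RHS]big_mkcond /=; apply: eq_bigr => j _.
case: ifPn => [jT | jNT]; last first.
  apply: big1 => A; rewrite powersetE => sAT.
  case: eqP => [EA | _]; last by rewrite scaler0 mulr0 mul0r.
  by rewrite EA sub1set (negPf jNT) in sAT.
rewrite (bigD1 [set j]) ?powersetE ?sub1set //= eqxx.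
rewrite big1 ?addr0 => [|A /andP[_ /negPf ->]].
  by rewrite -!scalerAr mulr1 -scalerAl.
by rewrite scaler0 mulr0 mul0r.
Qed.

(** For increasing [t], the elements of the image below [t l] are the [t k] with [k < l]. The
    resulting sign is that of a Laplace expansion along row 0. *)
Lemma inversions_homo m (t : 'I_m -> 'I_n) l :
  {homo t : i j / (i < j)%N} ->
  inversions [set t l] ([set t k | k : 'I_m] :\ t l) = l.
Proof.
move=> tH; have t_inj := homo_ltn_inj tH.
rewrite -[RHS]card_ord_lt -(card_imset _ t_inj).
(* The map [x |-> (t l, x)] is injective, with the second projection as left inverse. *)
rewrite -(card_imset (t @: _) (can_inj (fun x => erefl x : (fun p => p.2) (t l, x) = x))).
apply: eq_card => -[x y]; rewrite !inE /=; apply/idP/imsetP.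
  case/andP=> /and3P[/eqP-> y_l /imsetP[k _ Ey]] lt_yl; exists y => //.
  rewrite Ey imset_f // inE; rewrite Ey in lt_yl.
  case: (ltngtP k l) => // [/tH/ltn_trans/(_ lt_yl)|/val_inj Ekl].
    by rewrite ltnn.
  by rewrite Ekl ltnn in lt_yl.
case=> z /imsetP[k]; rewrite inE => lt_kl -> [-> ->].
by rewrite eqxx imset_f // tH // (inj_eq t_inj) -val_eqE /= ltn_eqF.
Qed.

(** By induction on [m]: wedging with the first 1-form is the expansion of the determinant along its
    first row. *)
Lemma wedge_one_form_minor m (w : 'I_m -> 'I_n -> K) (t : 'I_m -> 'I_n) :
  {homo t : i j / (i < j)%N} ->
  (\big[@wedge K n/@dform_one K n]_(k < m) one_form (w k)) [set t l | l : 'I_m] =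
  (\det (\matrix_(k, l) w k (t l)))%:MP.
Proof.
elim: m w t => [|m IHm] w t tH.
  rewrite big_ord0 ffunE det_mx00; case: eqP => // -[].
  by apply/setP=> x; rewrite inE; apply/imsetP=> -[[]].
rewrite big_ord_recl wedge_one_form big_imset /=; last by move=> ? ? _ _; apply: homo_ltn_inj.
rewrite (expand_det_row _ ord0) raddf_sum /=; apply: eq_bigr => l _.
rewrite inversions_homo //.
(* Removing [t l] amounts to reindexing by [lift l], which is the deletion of column [l] in the
   minor. *)
have ->: [set t k | k : 'I_m.+1] :\ t l = [set t (lift l k) | k : 'I_m].
  apply/setP=> x; rewrite !inE.
  apply/andP/imsetP => [[x_l /imsetP[k _ Ex]]|[k _ ->]].
    have /unlift_some[k' Ek _] : l != k by apply: contraNneq x_l => ->; rewrite Ex.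
    by exists k' => //; rewrite -Ek.
  by rewrite (inj_eq (homo_ltn_inj tH)) eq_sym neq_lift imset_f.
rewrite (IHm _ (fun k => t (lift l k))); last by move=> ? ? /(homo_ltn_lift l)/tH.
rewrite /cofactor mxE add0n mulrCA.
have ->: row' ord0 (col' l (\matrix_(k, l0) w k (t l0))) =
  \matrix_(k, l0) w (lift ord0 k) (t (lift l l0)) by apply/matrixP=> k l0; rewrite !mxE.
by rewrite mpolyCM (mpolyCM n (w _ _)) rmorphXn rmorphN1 mul_mpolyC.
Qed.

Lemma wedge_one_form_kform m (w : 'I_m -> 'I_n -> K) :
  is_kform m (\big[@wedge K n/@dform_one K n]_(k < m) one_form (w k)).
Proof.
elim: m w => [|m IHm] w T cardT.
  by rewrite big_ord0 ffunE -cards_eq0 (negPf cardT).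
rewrite big_ord_recl wedge_one_form big1 // => j jT.
rewrite IHm ?scaler0 ?mulr0 //.
by apply: contraNneq cardT => <-; rewrite (cardsD1 j T) jT.
Qed.

End Wedge.

(** * Linear substitutions and the two-sided action on polynomial tuples *)

Section Substitution.
Variables (K : fieldType) (n : nat).
Implicit Types (p : {mpoly K[n]}) (A B : 'M[K]_n) (f : polymap K n).

Definition linear_tuple A := [tuple linear_polymap A i | i < n].

Lemma tnth_linear_tuple A i : tnth (linear_tuple A) i = \sum_j A i j *: 'X_j.
Proof. by rewrite tnth_mktuple ffunE. Qed.

Lemma comp_linear_polymap A (q : n.-tuple {mpoly K[n]}) i :
  linear_polymap A i \mPo q = \sum_j A i j *: tnth q j.
Proof.
rewrite ffunE raddf_sum /=; apply: eq_bigr => j _.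
by rewrite comp_mpolyZ comp_mpolyXU -tnth_nth.
Qed.

Lemma comp_mpolyA p (q r : n.-tuple {mpoly K[n]}) :
  (p \mPo q) \mPo r = p \mPo [tuple tnth q i \mPo r | i < n].
Proof.
rewrite !(comp_mpolyE p) raddf_sum /=; apply: eq_bigr => m _.
rewrite comp_mpolyZ rmorph_prod /=; congr (_ *: _).
by apply: eq_bigr => i _; rewrite rmorphXn tnth_mktuple.
Qed.

Lemma comp_linear_tupleM p A B :
  (p \mPo linear_tuple A) \mPo linear_tuple B = p \mPo linear_tuple (A *m B).
Proof.
rewrite comp_mpolyA; congr (p \mPo _); apply: eq_from_tnth => i.
rewrite !tnth_mktuple comp_linear_polymap ffunE.
under eq_bigr => j _ do rewrite tnth_linear_tuple scaler_sumr.
rewrite exchange_big; apply: eq_bigr => k _ /=.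
by rewrite mxE scaler_suml; apply: eq_bigr => j _; rewrite scalerA.
Qed.

(** Homogeneity enters here: every monomial of [p] has degree [d], so it contributes the same factor
    [c ^+ d]. *)
Lemma comp_linear_tupleZ d p c A :
  p \is d.-homog -> p \mPo linear_tuple (c *: A) = c ^+ d *: (p \mPo linear_tuple A).
Proof.
move=> /dhomogP p_d; rewrite !(comp_mpolyE p) scaler_sumr !big_seq.
apply: eq_bigr => m /p_d <-; rewrite [RHS]scalerA mulrC -scalerA; congr (_ *: _).
rewrite /= mdegE expr_sum -scaler_prod; apply: eq_bigr => i _.
rewrite -exprZn !tnth_linear_tuple scaler_sumr; congr (_ ^+ _).
by apply: eq_bigr => j _; rewrite mxE scalerA.
Qed.

(** The outer and inner matrices are kept independent so that their scalar factors can be tracked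
    separately; [in_Aut] is the case where [B] is the inverse of [A]. *)
Definition conj_polymap A B f : polymap K n :=
  polymap_comp (linear_polymap A) (polymap_comp f (linear_polymap B)).

Lemma conj_polymapE A B f i :
  conj_polymap A B f i = \sum_j A i j *: (f j \mPo linear_tuple B).
Proof.
rewrite ffunE comp_linear_polymap.
by apply: eq_bigr => j _; rewrite tnth_mktuple ffunE.
Qed.

Lemma conj_polymapM A B A' B' f :
  conj_polymap A A' (conj_polymap B B' f) = conj_polymap (A *m B) (B' *m A') f.
Proof.
apply/ffunP=> i; rewrite [LHS]conj_polymapE [RHS]conj_polymapE.
under eq_bigr => j _ do rewrite (conj_polymapE B) (raddf_sum (comp_mpoly _)) /= scaler_sumr.
rewrite exchange_big; apply: eq_bigr => k _ /=.
rewrite mxE scaler_suml; apply: eq_bigr => j _.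
by rewrite comp_mpolyZ comp_linear_tupleM scalerA.
Qed.

Lemma conj_polymapZ A B c f : conj_polymap A B (c *: f) = c *: conj_polymap A B f.
Proof.
apply/ffunP=> i; rewrite [RHS]ffunE [LHS]conj_polymapE conj_polymapE scaler_sumr.
by apply: eq_bigr => j _; rewrite ffunE comp_mpolyZ !scalerA mulrC.
Qed.

Lemma conj_polymap_scale d A B a b f :
  (forall i, f i \is d.-homog) ->
  conj_polymap (a *: A) (b *: B) f = (a * b ^+ d) *: conj_polymap A B f.
Proof.
move=> f_d; apply/ffunP=> i; rewrite [RHS]ffunE [LHS]conj_polymapE conj_polymapE scaler_sumr.
apply: eq_bigr => j _.
by rewrite (comp_linear_tupleZ _ _ (f_d j)) mxE !scalerA mulrAC.
Qed.

End Substitution.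

(** * Coefficients of [form_of_map] and equivariance through the adjugate *)

Section FormOfMapTheory.
Variables (K : fieldType) (n : nat).
Implicit Types (f g : polymap K n.+1) (A : GL K n.+1).

Lemma one_form_row1 (i : 'I_n.+1) : one_form ((1%:M : 'M[K]_n.+1) i) = dx K i.
Proof.
rewrite /one_form (bigD1 i) //= mxE eqxx scale1r big1 ?addr0 // => j.
by rewrite eq_sym => /negPf ij; rewrite mxE ij scale0r.
Qed.

(** The coefficient is the minor of [B] without row [i] and column [j]; the extra sign cancels the
    one built into [cofactor]. *)
Lemma wedge_rows_setC1 (B : 'M[K]_n.+1) (i j : 'I_n.+1) :
  (\big[@wedge K n.+1/@dform_one K n.+1]_(k < n) one_form (B (lift i k)))
    (~: [set j]) = ((-1) ^+ (i + j) * cofactor B i j)%:MP.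
Proof.
rewrite -imset_lift wedge_one_form_minor; last exact: homo_ltn_lift.
rewrite /cofactor mulrA -exprD addnn -mul2n exprM sqrrN !expr1n mul1r.
by congr (\det _)%:MP; apply/matrixP=> k l; rewrite !mxE.
Qed.

Lemma sign_sigma (i : 'I_n.+1) : (-1) ^+ sigma i = (-1) ^+ i :> K.
Proof. by rewrite /sigma odd_lift_perm odd_perm1 addbF /= signr_odd. Qed.

(** The [dx] are the 1-forms given by the rows of the identity matrix, whose cofactors are Kronecker
    deltas because its adjugate is itself. *)
Lemma dXE (i : 'I_n.+1) S : dX K i S = ((-1) ^+ i *+ (S == ~: [set i]))%:MP.
Proof.
rewrite /dX ffunE sign_sigma.
under eq_bigr => k _ do rewrite -one_form_row1.
have [/card_setC1P[j ->] | cardS] := boolP (#|S| == n); last first.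
  rewrite wedge_one_form_kform // scaler0.
  case: eqP => [ES | _]; last by rewrite mpolyC0.
  by case/card_setC1P: cardS; exists i.
rewrite wedge_rows_setC1.
have -> : cofactor 1%:M i j = (i == j)%:R :> K.
  have /matrixP/(_ j i) := adj1 K n.+1; rewrite !mxE => ->.
  by rewrite eq_sym.
rewrite (inj_eq (can_inj (@setCK _))) (inj_eq set1_inj) eq_sym.
have [->|_] := eqVneq i j; last by rewrite mulr0 mulr0n !mpolyC0 scaler0.
by rewrite addnn -mul2n exprM sqrrN !expr1n mulr1 -mul_mpolyC -mpolyCM mulr1.
Qed.

Lemma form_of_mapE f S :
  form_of_map f S = \sum_(i < n.+1) ((-1) ^+ i *+ (S == ~: [set i])) *: f i.
Proof.
rewrite /form_of_map sum_ffunE; apply: eq_bigr => i _.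
by rewrite ffunE dXE mulrC mul_mpolyC.
Qed.

Lemma form_of_map_setC1 f (i : 'I_n.+1) : form_of_map f (~: [set i]) = (-1) ^+ i *: f i.
Proof.
rewrite form_of_mapE (bigD1 i) //= eqxx big1 ?addr0 // => j /negPf ji.
by rewrite (inj_eq (can_inj (@setCK _))) (inj_eq set1_inj) eq_sym ji scale0r.
Qed.

Lemma form_of_map_kform f : is_kform n (form_of_map f).
Proof.
move=> S cardS; rewrite form_of_mapE big1 // => i _.
case: eqP => [ES | _]; last by rewrite scale0r.
by case/card_setC1P: cardS; exists i.
Qed.

Lemma form_of_map_inj : injective (@form_of_map K n).
Proof.
move=> f g eq_fg; apply/ffunP=> i.
have /ffunP/(_ (~: [set i])) := eq_fg; rewrite !form_of_map_setC1.
by apply: scalerI; rewrite signr_eq0.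
Qed.

Lemma form_of_mapZ c f : form_of_map (c *: f) = c *: form_of_map f.
Proof.
apply/ffunP=> S; rewrite ffunE !form_of_mapE scaler_sumr.
by apply: eq_bigr => i _; rewrite ffunE !scalerA mulrC.
Qed.

Lemma form_of_map_eq0 f : (form_of_map f == 0) = (f == 0).
Proof.
have form0 : form_of_map (0 : polymap K n.+1) = 0.
  by rewrite -(scale0r 0) form_of_mapZ scale0r.
by rewrite -{1}form0 (inj_eq form_of_map_inj).
Qed.

(** Surjectivity onto [n]-forms: the sign [(-1) ^+ i] carried by [dX i] is its own inverse. *)
Lemma kform_form_of_map (phi : dform K n.+1) :
  is_kform n phi ->
  phi = form_of_map [ffun i : 'I_n.+1 => (-1) ^+ i *: phi (~: [set i])].
Proof.
move=> phi_n; apply/ffunP=> S.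
have [/card_setC1P[j ->] | cardS] := boolP (#|S| == n); last first.
  by rewrite phi_n // form_of_map_kform.
by rewrite form_of_map_setC1 ffunE scalerA -expr2 sqrr_sign scale1r.
Qed.

Lemma act_dform_form_of_map A f :
  act_dform A (form_of_map f) =
  \det (val A^-1%g) *: form_of_map (conj_polymap (val A) (val A^-1%g) f).
Proof.
apply/ffunP=> S; rewrite ffunE /act_dform sum_ffunE.
set B := val A^-1%g.
pose W (i : 'I_n.+1) : dform K n.+1 :=
  \big[@wedge K n.+1/@dform_one K n.+1]_(k < n) one_form (B (lift i k)).
(* The [i]-th component of [f] occurs only in the coefficient at [~: [set i]], so the double sum
   over [T] and [i] collapses to one over [i]. *)
transitivity (\sum_(i < n.+1) (-1) ^+ i *: ((f i \mPo linear_tuple B) * W i S)).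
  under eq_bigr => T _.
    rewrite ffunE form_of_mapE /act_poly raddf_sum mulr_suml /=.
    over.
  rewrite exchange_big; apply: eq_bigr => i _ /=.
  rewrite (bigD1 (~: [set i])) //= eqxx big1 ?addr0 => [|T /negPf ->]; last first.
    by rewrite scale0r raddf0 mul0r.
  by rewrite comp_mpolyZ -scalerAl enum_setC1 big_map enumT /W [index_enum _]unlock.
have [/card_setC1P[j ->] | cardS] := boolP (#|S| == n); last first.
  rewrite form_of_map_kform // scaler0 big1 // => i _.
  by rewrite wedge_one_form_kform // mulr0 scaler0.
rewrite form_of_map_setC1 conj_polymapE !scaler_sumr; apply: eq_bigr => i _.
rewrite wedge_rows_setC1 mulrC mul_mpolyC !scalerA; congr (_ *: _).
have -> : val A = invmx B by rewrite /B /= invmxK.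
have uB : B \in unitmx by apply: valP.
(* Cramer's rule turns the cofactor into an entry of [A]. The transposed indices make the sum over
   [i] the product of [A] with the substituted tuple. *)
have <- : \det B * invmx B j i = cofactor B i j.
  by rewrite /invmx uB !mxE mulrA mulfV ?mul1r // -unitfE -unitmxE.
rewrite [\det B * _ in RHS]mulrC -[RHS]mulrA [LHS]mulrA -exprD addnA addnn -mul2n exprD exprM sqrrN !expr1n.
by rewrite mul1r.
Qed.

End FormOfMapTheory.

(** * Extension of scalars from [K] to [L] and descent of proportionality *)

Section BaseChangeTheory.
Variables (K L : fieldType) (iota : {rmorphism K -> L}) (n : nat).
Implicit Types (f g : polymap K n) (p : {mpoly K[n]}).

Definition map_polymap f : polymap L n := [ffun i => map_mpoly iota (f i)].

Lemma map_mpoly_homog d p : p \is d.-homog -> map_mpoly iota p \is d.-homog.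
Proof.
move=> /dhomogP p_d; apply/dhomogP => m.
rewrite mcoeff_msupp mcoeff_map_mpoly fmorph_eq0 => p_m.
by apply: p_d; rewrite mcoeff_msupp.
Qed.

Lemma map_mpoly_linear_tuple p (A : 'M[K]_n) :
  map_mpoly iota (p \mPo linear_tuple A) =
  map_mpoly iota p \mPo linear_tuple (map_mx iota A).
Proof.
rewrite [LHS](congr1 _ (comp_mpolyE p _)) [p in RHS]mpolyE.
rewrite !(raddf_sum (map_mpoly iota)) raddf_sum /=; apply: eq_bigr => m _.
rewrite !map_mpolyZ map_mpolyX comp_mpolyZ comp_mpolyX rmorph_prod.
congr (_ *: _); apply: eq_bigr => i _; rewrite rmorphXn; congr (_ ^+ _).
rewrite !tnth_linear_tuple (raddf_sum (map_mpoly iota)); apply: eq_bigr => j _.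
by rewrite /= map_mpolyZ map_mpolyX mxE.
Qed.

Lemma map_conj_polymap (A B : 'M[K]_n) f :
  map_polymap (conj_polymap A B f) =
  conj_polymap (map_mx iota A) (map_mx iota B) (map_polymap f).
Proof.
apply/ffunP=> i; rewrite [LHS]ffunE [RHS]conj_polymapE conj_polymapE (raddf_sum (map_mpoly iota)) /=.
apply: eq_bigr => j _.
by rewrite map_mpolyZ map_mpoly_linear_tuple mxE ffunE.
Qed.

Lemma map_polymapZ c f : map_polymap (c *: f) = iota c *: map_polymap f.
Proof. by apply/ffunP=> i; rewrite !ffunE map_mpolyZ. Qed.

Lemma map_polymap_inj : injective map_polymap.
Proof.
move=> f g eq_fg; apply/ffunP=> i; apply/mpolyP=> m; apply: (fmorph_inj iota).
by have /ffunP/(_ i)/mpolyP/(_ m) := eq_fg; rewrite !ffunE !mcoeff_map_mpoly.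
Qed.

(** Supplies a coefficient to divide by when a proportionality factor must be recovered. *)
Lemma polymap_neq0 f :
  f != 0 -> exists im : 'I_n * 'X_{1..n}, (f im.1)@_im.2 != 0.
Proof.
move=> f0; have /existsP[i fi] : [exists i, f i != 0].
  apply: contraNT f0; rewrite negb_exists => /forallP f0.
  by apply/eqP/ffunP=> i; rewrite ffunE; apply/eqP/negPn.
by exists (i, mlead (f i)); rewrite mleadc_eq0.
Qed.

(* The factor is a quotient of coefficients, hence lies in K. *)
Lemma map_polymap_proportional f g (c : L) :
  c != 0 -> g != 0 -> map_polymap f = c *: map_polymap g -> proportional f g.
Proof.
move=> c0 /polymap_neq0[[i m] /= gim] eq_fg.
have Ec : c = iota ((f i)@_m / (g i)@_m).
  have /ffunP/(_ i)/mpolyP/(_ m) := eq_fg.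
  rewrite !ffunE mcoeffZ !mcoeff_map_mpoly fmorph_div => ->.
  by rewrite mulfK // fmorph_eq0.
rewrite Ec in c0 eq_fg; exists ((f i)@_m / (g i)@_m).
  by rewrite fmorph_eq0 in c0.
by apply: map_polymap_inj; rewrite map_polymapZ.
Qed.

End BaseChangeTheory.

Lemma map_form_of_map (K L : fieldType) (iota : {rmorphism K -> L}) n
    (f : polymap K n.+1) :
  map_dform iota (form_of_map f) = form_of_map (map_polymap iota f).
Proof.
apply/ffunP=> S; rewrite ffunE !form_of_mapE (raddf_sum (map_mpoly iota)); apply: eq_bigr => i _.
by rewrite /= map_mpolyZ ffunE rmorphMn rmorphXn rmorphN1.
Qed.

Lemma closed_field_root (L : closedFieldType) n (a : L) :
  (0 < n)%N -> exists c : L, c ^+ n = a.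
Proof.
move=> n_gt0.
(* The monic equation is [X^n = a]: the lower-degree side has constant term [a] and no other
   term. *)
have [c Ec] := solve_monicpoly (fun i => if i == 0%N then a else 0) n_gt0.
exists c; rewrite Ec; case: n n_gt0 {Ec} => // n _.
by rewrite big_ord_recl big1 ?addr0 ?mulr1 // => i _; rewrite mul0r.
Qed.

(** * Lifts to the special linear group, and invariance against automorphisms *)

Section SpecialLifts.
Variables (K : fieldType) (L : closedFieldType) (iota : {rmorphism K -> L}).
Variables (n : nat) (Gamma : {fset PGL K n.+1}).
Implicit Types (f : polymap K n.+1) (A : GL L n.+1) (a : PGL K n.+1).

Lemma SL_preimage_repr A : SL_preimage iota Gamma A ->
  exists2 a, a \in Gamma &
    exists2 c, c != 0 & val A = c *: map_mx iota (val (repr a)).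
Proof.
by case=> _ [a aG /eqP/PGL_classP[c c0 EA]]; exists a => //; exists c.
Qed.

Lemma SL_preimage_lift a : a \in Gamma ->
  exists2 A, SL_preimage iota Gamma A &
    exists2 c, c != 0 & val A = c *: map_mx iota (val (repr a)).
Proof.
move=> aG; set B := val (GL_map iota (repr a)).
have uB : B \in unitmx by apply: valP.
have dB : \det B != 0 by rewrite -unitfE -unitmxE.
(* Scaling a matrix of size [n.+1] by [c] multiplies its determinant by [c ^+ n.+1], so this [c]
   normalises the determinant to 1. *)
have [c Ec] := closed_field_root (\det B)^-1 (ltn0Sn n).
have c0 : c != 0 by apply: contraNneq dB => c0; rewrite -invr_eq0 -Ec c0 expr0n.
have ucB : c *: B \in unitmx by rewrite unitmxZ ?unitfE.
exists (Sub (c *: B) ucB : GL L n.+1); last by exists c; rewrite ?SubK.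
split; first by rewrite SubK detZ Ec mulVf.
by exists a => //; apply/eqP/PGL_classP; exists c; rewrite ?SubK.
Qed.

(** The outer matrix contributes [c], and the inverse inside a degree [d] tuple contributes
    [c^-1 ^+ d]. *)
Lemma conj_polymap_lift d f A a c :
    c != 0 -> val A = c *: map_mx iota (val (repr a)) ->
    (forall i, f i \is d.-homog) ->
  conj_polymap (val A) (val A^-1%g) (map_polymap iota f) =
  (c * c^-1 ^+ d) *:
    map_polymap iota (conj_polymap (val (repr a)) (invmx (val (repr a))) f).
Proof.
move=> c0 EA f_d; rewrite map_conj_polymap map_invmx.
have -> : val A^-1%g = c^-1 *: invmx (map_mx iota (val (repr a))).
  by rewrite /= EA invmxZ // -EA; apply: valP.
by rewrite EA (@conj_polymap_scale _ _ d) // => i; rewrite ffunE map_mpoly_homog.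
Qed.

Lemma act_form_of_map A f : SL_preimage iota Gamma A ->
  act_dform A (map_dform iota (form_of_map f)) =
  form_of_map (conj_polymap (val A) (val A^-1%g) (map_polymap iota f)).
Proof.
case=> detA _; rewrite map_form_of_map act_dform_form_of_map.
by rewrite /= det_inv detA invr1 scale1r.
Qed.

Lemma invariant_form_Aut f :
    is_projective_map f -> invariant_form iota Gamma (form_of_map f) ->
  forall a, a \in Gamma -> in_Aut f a.
Proof.
move=> [f0 [d f_d]] [chi [chi0 _] chiP] a aG.
have [A HA [c c0 EA]] := SL_preimage_lift aG.
have := chiP A HA; rewrite act_form_of_map // map_form_of_map -form_of_mapZ.
move/form_of_map_inj; rewrite (conj_polymap_lift c0 EA f_d) => Ef.
have cd0 : c * c^-1 ^+ d != 0 by rewrite mulf_neq0 // expf_neq0 ?invr_eq0.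
(* Conjugating [f] by the lift [A] gives [chi A] times [f], and also [c * c^-1 ^+ d] times the
   conjugate by [repr a]; [e] is the quotient of these scalars. *)
pose e := (c * c^-1 ^+ d)^-1 * chi A.
apply: (@map_polymap_proportional _ _ iota _ _ _ e) => //.
  by rewrite mulf_neq0 ?invr_eq0 ?chi0.
by rewrite -scalerA -Ef scalerA mulVf // scale1r.
Qed.

Lemma Aut_invariant_form f :
    is_projective_map f -> (forall a, a \in Gamma -> in_Aut f a) ->
  invariant_form iota Gamma (form_of_map f).
Proof.
move=> [f0 [d f_d]] autf; set F := map_polymap iota f.
pose cj A := conj_polymap (val A) (val A^-1%g) F.
have cjP A : SL_preimage iota Gamma A -> proportional (cj A) F.
  case/SL_preimage_repr=> a aG [c c0 EA]; have [b b0 Eb] := autf a aG.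
  exists (c * c^-1 ^+ d * iota b).
    by rewrite !mulf_neq0 ?fmorph_eq0 // expf_neq0 ?invr_eq0.
  by rewrite /cj (conj_polymap_lift c0 EA f_d) -[RHS]scalerA -map_polymapZ -Eb.
have F0 : exists im : 'I_n.+1 * 'X_{1..n.+1}, (F im.1)@_im.2 != 0.
  have [[i m] fim] := polymap_neq0 f0; exists (i, m).
  by rewrite ffunE mcoeff_map_mpoly fmorph_eq0.
have [[i m] /= Fim] := F0.
(* Reading the scalar off one fixed nonzero coefficient of [F] gives a total function on the general
   linear group; it is the proportionality factor wherever [cj A] is a multiple of [F]. *)
pose chi A := (cj A i)@_m / (F i)@_m.
have chiE A c : cj A = c *: F -> chi A = c.
  by rewrite /chi => ->; rewrite ffunE mcoeffZ mulfK.
have cjE A : SL_preimage iota Gamma A -> cj A = chi A *: F.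
  by case/cjP=> c _ Ec; rewrite (chiE _ _ Ec).
clearbody chi; exists chi; first split.
- by move=> A /cjP[c c0 /chiE ->].
(* Conjugation by a product is iterated conjugation, and each stage multiplies [F] by a scalar, so
   the scalars multiply. *)
- move=> A B HA HB; apply: chiE.
  have -> : cj (A * B)%g = conj_polymap (val A) (val A^-1%g) (cj B).
    rewrite /cj invgM.
    by rewrite (conj_polymapM (val A) (val B) (val A^-1%g) (val B^-1%g) F).
  rewrite (cjE B HB); transitivity (chi B *: cj A); first exact: conj_polymapZ.
  by rewrite (cjE A HA) [LHS]scalerA [chi B * _]mulrC.
move=> A HA; rewrite map_form_of_map -form_of_mapZ -(cjE A HA) -map_form_of_map.
exact: act_form_of_map.
Qed.

End SpecialLifts.

Theorem mainTheorem1 (K : fieldType) (L : closedFieldType)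
    (iota : {rmorphism K -> L}) (algL : forall z : L, algebraicOver iota z)
    (n : nat) (n_gt0 : (1 <= n)%N)
    (Gamma : {fset PGL K n.+1}) (groupGamma : group_closed (mem Gamma)) :
  [/\ forall phi : dform K n.+1,
        phi != 0 -> is_kform n phi -> homog_coefs phi ->
        invariant_form iota Gamma phi ->
        exists! f : polymap K n.+1,
          [/\ is_projective_map f,
              forall a, a \in Gamma -> in_Aut f a
            & phi = form_of_map f],
      forall f : polymap K n.+1,
        is_projective_map f -> (forall a, a \in Gamma -> in_Aut f a) ->
        [/\ form_of_map f != 0, is_kform n (form_of_map f),
            homog_coefs (form_of_map f)
          & invariant_form iota Gamma (form_of_map f)]
    & forall f g : polymap K n.+1,
        is_projective_map f -> is_projective_map g ->
        (proportional (form_of_map f) (form_of_map g) <-> proportional f g)].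
Proof.
split=> [phi phi0 phi_n [d phi_d] phi_inv | f [f0 [d f_d]] autf | f g _ _].
- set f : polymap K n.+1 := [ffun i : 'I_n.+1 => (-1) ^+ i *: phi (~: [set i])].
  have Ephi : phi = form_of_map f := kform_form_of_map phi_n.
  have f_proj : is_projective_map f.
    split; first by rewrite -form_of_map_eq0 -Ephi.
    by exists d => i; rewrite ffunE; apply: dhomogZ.
  exists f; split=> [|g [_ _ Eg]]; last by apply: form_of_map_inj; rewrite -Ephi.
  by split=> //; apply: (invariant_form_Aut f_proj); rewrite -Ephi; apply: phi_inv.
- split; first by rewrite form_of_map_eq0.
  + exact: form_of_map_kform.
  + exists d => S; rewrite form_of_mapE; apply: rpred_sum => i _; exact: dhomogZ.
  by apply: Aut_invariant_form => //; split=> //; exists d.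
(* Linearity and injectivity of [form_of_map] make the bijection pass to classes up to nonzero
   scalars, that is, to maps of projective space. *)
split=> -[c c0 E]; exists c => //; last by rewrite E form_of_mapZ.
by apply: form_of_map_inj; rewrite E form_of_mapZ.
Qed.
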